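(* There exists a Bayesian network $G$ on five binary random variables such that the local Markov ideal $I_{\mathrm{local}(G)}\subset\mathbb{R}[p_{11111},p_{11112},\dots,p_{22222}]$ is not radical.
   Context: Independence ideals. Let $X_1,\dots,X_n$ be discrete random variables, $X_i$ taking values in $[d_i]=\{1,\dots,d_i\}$ (binary means $d_i=2$), and $D=[d_1]\times\cdots\times[d_n]$. $\mathbb{R}[D]$ is the polynomial ring over $\mathbb{R}$ in the unknowns $p_{u_1\cdots u_n}$, $(u_1,\dots,u_n)\in D$. For pairwise disjoint $A,B,C\subseteq\{X_1,\dots,X_n\}$ and tuples of values $a,b,c$ of the variables in $A,B,C$, let $p_{a,b,c,+}$ be the sum of all $p_u$ over $u\in D$ whose coordinates in $A,B,C$ are $a,b,c$. The ideal $I_{A\perp B\mid C}$ is generated by all $p_{a,b,c,+}\,p_{a',b',c,+}-p_{a,b',c,+}\,p_{a',b,c,+}$ (it is $0$ if $A$ or $B$ is empty). The ideal of a set of statements $A\perp B\mid C$ is the sum of the corresponding ideals. Bayesian networks. A Bayesian network is an acyclic directed graph $G$ with vertices $X_1,\dots,X_n$. Let $\mathrm{pa}(X_i)$ be the set of parents of $X_i$ and $\mathrm{nd}(X_i)$ the set of nondescendents of $X_i$, i.e. vertices $X_j\ne X_i$, not parents of $X_i$, such that there is no directed path from $X_i$ to $X_j$. Then $\mathrm{local}(G)=\{X_i\perp\mathrm{nd}(X_i)\mid\mathrm{pa}(X_i): i=1,\dots,n\}$, and $I_{\mathrm{local}(G)}$ is the ideal of this set of statements. *)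

(* Defs.v *)
From mathcomp Require Import all_boot all_order all_algebra.
From mathcomp Require Import reals.
From mathcomp Require Import mpoly.

Set Implicit Arguments.
Unset Strict Implicit.
Unset Printing Implicit Defensive.

Import GRing.Theory.
Local Open Scope ring_scope.

Section Ideals.
Variable A : comNzRingType.

Definition gen_ideal (S : A -> Prop) (f : A) : Prop :=
  exists s : seq (A * A),
    (forall x, x \in s -> S x.2) /\ f = \sum_(x <- s) x.1 * x.2.

Definition sum_ideal (T : finType) (S : {set T}) (I : T -> A -> Prop) (f : A)
    : Prop :=
  exists g : T -> A,
    (forall t, t \in S -> I t (g t)) /\ f = \sum_(t in S) g t.

Definition is_radical (I : A -> Prop) : Prop :=
  forall (f : A) (k : nat), (0 < k)%N -> I (f ^+ k) -> I f.
End Ideals.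

Section Independence.
Variables (R : realType) (n : nat) (d : 'I_n -> nat).

(* The d i values of the i-th variable are numbered from 0 to d i - 1. *)
Definition state : finType := {dffun forall i : 'I_n, 'I_(d i)}.

Definition values (A : {set 'I_n}) : finType :=
  {dffun forall i : {i : 'I_n | i \in A}, 'I_(d (val i))}.

Definition agrees (A : {set 'I_n}) (u : state) (a : values A) : bool :=
  [forall i, u (val i) == a i].

(* The polynomial unknowns are indexed by the rank of the state in the
   enumeration of all states. *)
Definition pvar (u : state) : {mpoly R[#|state|]} := 'X_(enum_rank u).

Definition pmarg (A B C : {set 'I_n}) (a : values A) (b : values B)
    (c : values C) : {mpoly R[#|state|]} :=
  \sum_(u : state | [&& agrees u a, agrees u b & agrees u c]) pvar u.

(* (A, B, C) stands for the statement "A is independent of B given C".  The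
   three sets are meant to be pairwise disjoint, which is automatic for the
   local Markov statements of an acyclic graph.  When A (or B) is empty there
   is only one a (or b), so that all the generators are 0. *)
Definition ci_stmt : finType :=
  ({set 'I_n} * {set 'I_n} * {set 'I_n})%type.

Definition ci_gen (s : ci_stmt) (f : {mpoly R[#|state|]}) : Prop :=
  let: (A, B, C) := s in
  exists (a a' : values A) (b b' : values B) (c : values C),
    f = pmarg a b c * pmarg a' b' c - pmarg a b' c * pmarg a' b c.

Definition ci_ideal (s : ci_stmt) : {mpoly R[#|state|]} -> Prop :=
  gen_ideal (ci_gen s).

Definition ci_set_ideal (S : {set ci_stmt}) : {mpoly R[#|state|]} -> Prop :=
  sum_ideal S ci_ideal.
End Independence.

Section BayesianNetworks.
Variable n : nat.

(* G i j means that there is an edge from i to j.  The cycles of path.cycle are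
   closed walks, loops and the empty sequence included. *)
Definition acyclic (G : rel 'I_n) : Prop :=
  forall c : seq 'I_n, path.cycle G c -> c = [::].

Definition pa (G : rel 'I_n) (i : 'I_n) : {set 'I_n} := [set j | G j i].

(* Parents of i do not count as nondescendents here. *)
Definition nd (G : rel 'I_n) (i : 'I_n) : {set 'I_n} :=
  [set j | [&& j != i, j \notin pa G i & ~~ connect G i j]].

Definition local_markov (G : rel 'I_n) : {set ci_stmt n} :=
  [set ([set i], nd G i, pa G i) | i : 'I_n].
End BayesianNetworks.

Definition binary (n : nat) : 'I_n -> nat := fun=> 2.

Definition local_ideal (R : realType) (n : nat) (d : 'I_n -> nat)
    (G : rel 'I_n) : {mpoly R[#|state d|]} -> Prop :=
  @ci_set_ideal R n d (local_markov G).

Arguments local_ideal R [n] d G _.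
Arguments binary n _ : clear implicits.

(* Main.v *)
Require Import Defs.
From HB Require Import structures.
From mathcomp Require Import all_boot all_order all_algebra.
From mathcomp Require Import reals mpoly.
From mathcomp Require Import ring.

(** The network has three sources 0, 1, 2, all of them parents of 3, and a
    single further edge from 3 to 4.  Write [x] and [y] for the tensors of
    unknowns with (variable 3, variable 4) equal to (0, 0) and (1, 0),
    seen as matrices with rows indexed by variable 0 and columns by the joint
    value of variables 1 and 2; write [q] and [r] for the corresponding sums
    over the leaf 4, and [t = q + r].  The statement at the leaf puts the 2x2
    minors of the pairs of vectors (x, q) and (y, r) in the ideal, and the
    statement at 0 puts the 2x2 minors of the matrix [t] there.

    Where [q = r = 0], the leaf statement holds for all [x] and [y].  Near a
    general such point [q = s x] and [r = t' y] for two local parameters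
    [s], [t'], and the minors of [s x + t' y] are quadratic forms in
    [s], [t'] numerous enough to span all of them, so the locus [q = r = 0] is
    a component with a nonreduced structure.  This is made explicit by one
    cubic: the determinant [g] of three columns of the matrix with rows [y_0],
    [x_0] and [t_1] (the rows being indexed by variable 0).

    The square of [g] is in the ideal ([cubic_squared]).  Modulo the minors,
    [q_k det(y_0, x_0, t_1) = x_k det(y_0, q_0, t_1)], and [q_0 = t_0 - r_0]
    splits this into a determinant with rows [t_0], [t_1] and one with rows
    [y_0], [r_0], both in the ideal.  By symmetry [r_k g] is in the ideal too,
    hence so is [t_k g], and [g] is linear in its row [t_1].

    The cubic itself is not in the ideal ([curve_local], [curve_cubic]): along
    the tangent direction [q = X x], [r = X y] every generator vanishes
    modulo [X ^ 2], whereas [g] becomes [X det(y_0, x_0, x_1 + y_1)], and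
    [x], [y] can be chosen to make this determinant 1. *)

Set Implicit Arguments.
Unset Strict Implicit.
Unset Printing Implicit Defensive.

Import GRing.Theory.
Local Open Scope ring_scope.

(** * Ideals *)

Definition ideal_closed (A : comNzRingType) (I : A -> Prop) : Prop :=
  [/\ I 0, forall f g, I f -> I g -> I (f + g) & forall h f, I f -> I (h * f)].

Lemma ideal_opp (A : comNzRingType) (I : A -> Prop) f :
  ideal_closed I -> I f -> I (- f).
Proof. by case=> _ _ IM If; rewrite -mulN1r; apply: IM. Qed.

Lemma ideal_sub (A : comNzRingType) (I : A -> Prop) f g :
  ideal_closed I -> I f -> I g -> I (f - g).
Proof. by move=> II If Ig; case: (II) => _ ID _; apply: ID => //; apply: ideal_opp. Qed.

Lemma gen_ideal_closed (A : comNzRingType) (S : A -> Prop) :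
  ideal_closed (gen_ideal S).
Proof.
split.
- by exists [::]; rewrite big_nil.
- move=> f g [s [Ss ->]] [t [St ->]]; exists (s ++ t); rewrite big_cat.
  by split=> // x; rewrite mem_cat => /orP[/Ss|/St].
- move=> h f [s [Ss ->]]; exists [seq (h * x.1, x.2) | x <- s]; split.
    by move=> _ /mapP[x /Ss Sx ->].
  by rewrite big_map mulr_sumr; apply: eq_bigr => x _; rewrite mulrA.
Qed.

Lemma gen_ideal_gen (A : comNzRingType) (S : A -> Prop) f :
  S f -> gen_ideal S f.
Proof.
move=> Sf; exists [:: (1, f)]; rewrite big_seq1 mul1r; split=> // x.
by rewrite inE => /eqP ->.
Qed.

Lemma gen_ideal_min (A : comNzRingType) (S I : A -> Prop) :
  ideal_closed I -> (forall f, S f -> I f) -> forall f, gen_ideal S f -> I f.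
Proof.
case=> I0 ID IM SI f [s [Ss ->]]; rewrite big_seq.
by apply: big_ind => // x xs; apply/IM/SI/Ss.
Qed.

Lemma sum_ideal_closed (A : comNzRingType) (T : finType) (S : {set T})
    (I : T -> A -> Prop) :
  (forall t, ideal_closed (I t)) -> ideal_closed (sum_ideal S I).
Proof.
move=> II; split.
- exists (fun=> 0); rewrite big1 //; split=> // t _; by case: (II t).
- move=> f g [u [Iu ->]] [v [Iv ->]]; exists (fun t => u t + v t).
  rewrite big_split; split=> // t tS; case: (II t) => _ ID _.
  by apply: ID; [apply: Iu | apply: Iv].
- move=> h f [u [Iu ->]]; exists (fun t => h * u t); rewrite mulr_sumr.
  by split=> // t tS; case: (II t) => _ _ IM; apply/IM/Iu.
Qed.

Lemma sum_ideal_mem (A : comNzRingType) (T : finType) (S : {set T})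
    (I : T -> A -> Prop) t f :
  (forall t', ideal_closed (I t')) -> t \in S -> I t f -> sum_ideal S I f.
Proof.
move=> II tS If; exists (fun t' => if t' == t then f else 0); split.
  by move=> t' _; case: eqP => [->|] //; case: (II t').
rewrite (big_setD1 t tS) /= eqxx big1 ?addr0 // => t' /setD1P[tt' _].
by rewrite (negPf tt').
Qed.

Lemma sum_ideal_min (A : comNzRingType) (T : finType) (S : {set T})
    (I : T -> A -> Prop) (K : A -> Prop) :
  ideal_closed K -> (forall t f, t \in S -> I t f -> K f) ->
  forall f, sum_ideal S I f -> K f.
Proof.
case=> K0 KD _ IK f [g [Ig ->]].
by apply: big_ind => // t tS; apply: (IK t) => //; apply: Ig.
Qed.

(** * The nilpotent cubic *)

Definition det3 (A : comNzRingType) (a b c : nat -> A) : A :=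
  a 0%N * (b 1%N * c 2 - b 2 * c 1%N)
  - a 1%N * (b 0%N * c 2 - b 2 * c 0%N)
  + a 2 * (b 0%N * c 1%N - b 1%N * c 0%N).

(** Laplace expansion along the first row. *)
Lemma det3_minors (A : comNzRingType) (I : A -> Prop) (a b c : nat -> A) :
  ideal_closed I -> (forall j k, I (b j * c k - b k * c j)) -> I (det3 a b c).
Proof.
move=> II bc; case: (II) => _ ID IM.
by apply: ID; [apply: ideal_sub => //|]; apply: IM.
Qed.

Lemma det3_entries (A : comNzRingType) (I : A -> Prop) (a b c : nat -> A) :
  ideal_closed I -> (forall k, I (a k)) -> I (det3 a b c).
Proof.
move=> II Ia; case: (II) => _ ID IM.
by apply: ID; [apply: ideal_sub => //|]; rewrite mulrC; apply: IM.
Qed.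

Section Cubic.
Variables (A : comNzRingType) (I : A -> Prop) (x q y r : bool -> nat -> A).
Let t i k := q i k + r i k.
Hypothesis II : ideal_closed I.
Hypothesis xq : forall i j k l, I (x i j * q k l - x k l * q i j).
Hypothesis yr : forall i j k l, I (y i j * r k l - y k l * r i j).
Hypothesis tt_minor : forall j k, I (t false j * t true k - t false k * t true j).

Let g := det3 (y false) (x false) (t true).

(** Trading [q_k x_0] for [x_k q_0] and then writing [q_0 = t_0 - r_0] leaves
    only determinants with a pair of rows whose minors lie in [I]. *)
Lemma q_annihilates_cubic i k : I (q i k * g).
Proof.
case: (II) => _ ID IM.
have -> : q i k * g =
    det3 (fun l => x false l * q i k - x i k * q false l) (t true) (y false)
    + x i k * (det3 (y false) (t false) (t true)
               - det3 (t true) (y false) (r false)).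
  by rewrite /g /t /det3; ring.
apply: ID; first exact: det3_entries.
by apply: IM; apply: ideal_sub => //; apply: det3_minors.
Qed.

Lemma r_annihilates_cubic i k : I (r i k * g).
Proof.
case: (II) => _ ID IM.
have -> : r i k * g =
    det3 (fun l => y false l * r i k - y i k * r false l) (x false) (t true)
    - y i k * (det3 (x false) (t false) (t true)
               - det3 (t true) (x false) (q false)).
  by rewrite /g /t /det3; ring.
apply: ideal_sub => //; first exact: det3_entries.
by apply: IM; apply: ideal_sub => //; apply: det3_minors.
Qed.

(** The cubic is linear in its row [t true], which annihilates it modulo
    [I]. *)
Lemma cubic_squared : I (g ^+ 2).
Proof.
case: (II) => _ ID IM.
have tg k : I (t true k * g).
  have -> : t true k * g = q true k * g + r true k * g by exact: mulrDl.
  by apply: ID; [apply: q_annihilates_cubic | apply: r_annihilates_cubic].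
have -> : g ^+ 2 = det3 (fun k => t true k * g) (y false) (x false).
  by rewrite expr2 {1}/g /det3; ring.
exact: det3_entries.
Qed.

End Cubic.

(** * Marginals *)

Section Marginals.
Variables (R : realType) (n : nat).
Local Notation d := (binary n).

(** Taking the values of a set of variables from a full state avoids
    dependent types in the generators: the marginal at compatible values of
    [A], [B], [C] only depends on a state and on the union of the three sets. *)
Definition restr (A : {set 'I_n}) (u : state d) : values d A :=
  [ffun i => u (val i)].

Definition marginal (K : {set 'I_n}) (u : state d) : {mpoly R[#|state d|]} :=
  \sum_(v : state d | [forall (i | i \in K), v i == u i]) pvar R v.

Definition upd (u : state d) (i : 'I_n) (b : 'I_2) : state d :=
  [ffun j => if j == i then b else u j].

Lemma agrees_restr (A : {set 'I_n}) (u v : state d) :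
  agrees v (restr A u) = [forall (i | i \in A), v i == u i].
Proof.
apply/forallP/forall_inP => [vu i iA|vu [i iA]].
  by have := vu (exist _ i iA); rewrite ffunE.
by rewrite ffunE; apply: vu.
Qed.

Lemma pmarg_restr (A B C : {set 'I_n}) (u : state d) :
  pmarg R (restr A u) (restr B u) (restr C u) = marginal (A :|: B :|: C) u.
Proof.
apply: eq_bigl => v; rewrite !agrees_restr.
apply/and3P/forall_inP => [[/forall_inP vA /forall_inP vB /forall_inP vC] i|vu].
  by rewrite !inE => /orP[/orP[/vA|/vB]|/vC].
by split; apply/forall_inP => i iK; apply: vu; rewrite !inE iK ?orbT.
Qed.

Lemma eq_restr (A : {set 'I_n}) (u v : state d) :
  (forall i, i \in A -> u i = v i) -> restr A u = restr A v.
Proof. by move=> uv; apply/ffunP => -[i iA]; rewrite !ffunE; apply: uv. Qed.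

(** [v] and [v'] are obtained from [u] and [u'] by exchanging their
    [B]-parts. *)
Lemma marginal_minor (A B C : {set 'I_n}) (u u' v v' : state d) :
  (forall i, i \in A -> v i = u i /\ v' i = u' i) ->
  (forall i, i \in B -> v i = u' i /\ v' i = u i) ->
  (forall i, i \in C -> [/\ u' i = u i, v i = u i & v' i = u i]) ->
  let m := marginal (A :|: B :|: C) in
  ci_gen (A, B, C) (m u * m u' - m v * m v').
Proof.
move=> hA hB hC; exists (restr A u), (restr A u'), (restr B u), (restr B u').
exists (restr C u); rewrite -!pmarg_restr.
rewrite (@eq_restr A v u) => [|i /hA[]//]; rewrite (@eq_restr A v' u') => [|i /hA[]//].
rewrite (@eq_restr B v u') => [|i /hB[]//]; rewrite (@eq_restr B v' u) => [|i /hB[]//].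
rewrite (@eq_restr C u' u) => [|i /hC[]//]; rewrite (@eq_restr C v u) => [|i /hC[]//].
by rewrite (@eq_restr C v' u) => [|i /hC[]//].
Qed.

Lemma marginal_setT (u : state d) : marginal setT u = pvar R u.
Proof.
rewrite /marginal (big_pred1 u) // => v.
apply/forall_inP/eqP => [vu|-> //].
by apply/ffunP => i; apply/eqP/vu; rewrite inE.
Qed.

Lemma marginal_split (K : {set 'I_n}) (i : 'I_n) (u : state d) :
  i \notin K ->
  marginal K u = \sum_(b : 'I_2) marginal (i |: K) (upd u i b).
Proof.
move=> iK; rewrite /marginal (partition_big (fun v : state d => v i : 'I_2) predT) //.
apply: eq_bigr => b _; apply: eq_bigl => v.
apply/andP/forall_inP => [[/forall_inP vu vi] j|vu].
  by rewrite !inE ffunE; case: (eqVneq j i) => [-> _|_ /vu].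
split; last by have := vu i; rewrite ffunE eqxx; apply; rewrite !inE eqxx.
apply/forall_inP => j jK; have := vu j; rewrite ffunE !inE jK orbT.
by case: (eqVneq j i) => [ji|_]; [rewrite -ji jK in iK | apply].
Qed.

End Marginals.

(** * The network *)

Definition node (k : nat) (lt_k5 : (k < 5)%N) : 'I_5 := Ordinal lt_k5.
Local Notation source := (@node 0 isT).
Local Notation mid := (@node 3 isT).
Local Notation leaf := (@node 4 isT).

Definition funnel : rel 'I_5 := fun i j =>
  ((i < 3)%N && (j == 3 :> nat)) || ((i == 3 :> nat) && (j == 4 :> nat)).

Lemma funnel_lt : subrel funnel (fun i j : 'I_5 => (i < j)%N).
Proof. by move=> i j /orP[/andP[i3 /eqP ->]|/andP[/eqP -> /eqP ->]]. Qed.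

Lemma funnel_acyclic : acyclic funnel.
Proof.
case=> // x p /(sub_path funnel_lt) /= xp.
have /(order_path_min (fun _ _ _ => @ltn_trans _ _ _)) := xp.
by move/allP/(_ x); rewrite mem_rcons inE eqxx ltnn => /(_ isT).
Qed.

(** All edges end at 3 or 4. *)
Lemma connect_funnel i j : connect funnel i j -> j = i \/ (3 <= j)%N.
Proof.
case/connectP => p; elim/last_ind: p => [_ -> |p x _]; first by left.
rewrite rcons_path last_rcons => /andP[_ fx] ->; right.
by case/orP: fx => /andP[_ /eqP ->].
Qed.

Lemma connect_leaf i : connect funnel i leaf.
Proof.
have mid_leaf : connect funnel mid leaf by apply: connect1.
case: (ltnP i 3) => [i3|].
  by apply: connect_trans mid_leaf; apply: connect1; rewrite /funnel i3.
case: i => [[|[|[|[|[|//]]]]] lt_i5] // _.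
  by rewrite (_ : Ordinal _ = mid) //; apply: val_inj.
by rewrite (_ : Ordinal _ = leaf) //; apply: val_inj.
Qed.

Lemma nd_funnel (i j : 'I_5) : (j < 3)%N -> j != i -> i != mid -> j \in nd funnel i.
Proof.
move=> j3 ji im; rewrite !inE ji /=; apply/andP; split.
  by rewrite /funnel j3 (ltn_eqF j3) orbF; apply: im.
by apply/negP => /connect_funnel[jeq|]; [rewrite jeq eqxx in ji | rewrite leqNgt j3].
Qed.

Lemma nd_root (j : 'I_5) : j \in nd funnel source -> (j < 3)%N.
Proof.
rewrite !inE => /and3P[_ _]; apply: contraNT; rewrite -leqNgt => j3.
have root_mid : connect funnel source mid by apply: connect1.
case: j j3 => [[|[|[|[|[|//]]]]] lt_j5] // _.
  by rewrite (_ : Ordinal _ = mid) //; apply: val_inj.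
by rewrite (_ : Ordinal _ = leaf) ?connect_leaf //; apply: val_inj.
Qed.

(** * The cubic lies in the radical *)

Definition bit (b : bool) : 'I_2 := if b then ord_max else ord0.

Definition outcome (s : seq bool) : state (binary 5) :=
  [ffun i : 'I_5 => bit (nth false s i)].

Lemma sum_bit (V : nmodType) (F : 'I_2 -> V) :
  \sum_b F b = F (bit false) + F (bit true).
Proof.
rewrite 2!big_ord_recl big_ord0 addr0; congr (_ + F _).
by apply: val_inj.
Qed.

Lemma upd_outcome (i : 'I_5) b (s : seq bool) :
  upd (outcome s) i (bit b) = outcome (set_nth false s i b).
Proof.
apply/ffunP => j; rewrite !ffunE nth_set_nth /= (inj_eq val_inj).
by case: eqP.
Qed.

Section Radical.
Variable R : realType.
Local Notation J := (local_ideal R (binary 5) funnel).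

(** Of the four columns of the matrices only three occur in the cubic:
    [j = 0, 1, 2] stands for the values (0, 0), (1, 0), (0, 1) of variables
    1 and 2. *)
Definition cell (c e i : bool) (j : nat) : seq bool :=
  [:: i; j == 1; j == 2; c; e].

Definition slice (c e i : bool) (j : nat) : {mpoly R[#|state (binary 5)|]} :=
  pvar R (outcome (cell c e i j)).

Definition slice_sum (c i : bool) (j : nat) := slice c false i j + slice c true i j.

Definition cubic : {mpoly R[#|state (binary 5)|]} :=
  det3 (slice true false false) (slice false false false)
    (fun j => slice_sum false true j + slice_sum true true j).

Lemma local_ideal_closed : ideal_closed J.
Proof.
apply: sum_ideal_closed => -[[A B] C]; exact: gen_ideal_closed.
Qed.

Lemma local_ideal_gen i f :
  ci_gen ([set i], nd funnel i, pa funnel i) f -> J f.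
Proof.
move=> gf; apply: (sum_ideal_mem (t := ([set i], nd funnel i, pa funnel i))).
- by move=> t; apply: gen_ideal_closed.
- exact: imset_f.
- exact: gen_ideal_gen.
Qed.

Lemma outcome_eq (s s' : seq bool) (i : 'I_5) :
  nth false s i = nth false s' i -> outcome s i = outcome s' i.
Proof. by rewrite !ffunE => ->. Qed.

(** Replacing the second slice by the sum of the two slices does not change
    the minors. *)
Lemma leaf_minor c i j k l :
  J (slice c false i j * slice_sum c k l - slice c false k l * slice_sum c i j).
Proof.
have -> : slice c false i j * slice_sum c k l
          - slice c false k l * slice_sum c i j =
          slice c false i j * slice c true k l
          - slice c false k l * slice c true i j.
  by rewrite /slice_sum; ring.
apply: (@local_ideal_gen leaf); rewrite /slice -!marginal_setT.
have <- : [set leaf] :|: nd funnel leaf :|: pa funnel leaf = setT.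
  apply/setP => v; rewrite in_setU [in RHS]inE.
  case: (ltnP v 3) => v3.
    by rewrite in_setU nd_funnel ?orbT //; apply: contraTneq v3 => ->.
  by case: v v3 => [[|[|[|[|[|//]]]]] lt_v5] // _; rewrite !inE ?orbT.
apply: marginal_minor => v.
- by rewrite inE => /eqP ->; split; apply: outcome_eq.
- rewrite !inE /funnel => /and3P[nl npa _].
  case: v nl npa => [[|[|[|[|[|//]]]]] lt_v5] //= nl npa;
    by split; apply: outcome_eq.
- rewrite inE /funnel /= andbF andbT => /eqP v3.
  by split; apply: outcome_eq; rewrite v3.
Qed.

Lemma marginal_root i j :
  marginal R [set v : 'I_5 | (v < 3)%N] (outcome (cell false false i j)) =
  slice_sum false i j + slice_sum true i j.
Proof.
rewrite (@marginal_split _ _ _ mid) ?inE // sum_bit.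
rewrite !(@marginal_split _ _ (mid |: _) leaf) ?inE // !sum_bit !upd_outcome.
have -> : leaf |: (mid |: [set v : 'I_5 | (v < 3)%N]) = setT.
  by apply/setP => -[[|[|[|[|[|//]]]]] lt_v5]; rewrite !inE.
by rewrite !marginal_setT.
Qed.

Lemma root_minor j k :
  let t i l := slice_sum false i l + slice_sum true i l in
  J (t false j * t true k - t false k * t true j).
Proof.
rewrite /= -!marginal_root; apply: (@local_ideal_gen source).
have <- : [set source] :|: nd funnel source :|: pa funnel source =
          [set v : 'I_5 | (v < 3)%N].
  apply/setP => v; have pa0 : v \in pa funnel source = false.
    by rewrite inE /funnel /= !andbF.
  rewrite 2!in_setU pa0 orbF in_set1 inE; apply/idP/idP => [|v3].
    by case/orP => [/eqP -> //|]; apply: nd_root.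
  by case: eqVneq => //= v0; apply: nd_funnel.
apply: marginal_minor => v.
- by rewrite inE => /eqP ->; split; apply: outcome_eq.
- move=> vnd; have v3 := nd_root vnd; move: vnd; rewrite !inE => /andP[v0 _].
  by case: v v3 v0 => [[|[|[|//]]] lt_v5] // _ _; split; apply: outcome_eq.
- by rewrite inE /funnel /= !andbF.
Qed.

Lemma cubic_sqr_local : J (cubic ^+ 2).
Proof.
apply: (@cubic_squared _ J (slice false false) (slice_sum false)
          (slice true false) (slice_sum true)).
- exact: local_ideal_closed.
- by move=> *; apply: leaf_minor.
- by move=> *; apply: leaf_minor.
- exact: root_minor.
Qed.

End Radical.

(** * The cubic does not lie in the ideal *)

Section DualNumbers.
Variable R : realType.
Local Notation J := (local_ideal R (binary 5) funnel).
Local Notation state5 := (state (binary 5)).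

(** The two weights sum to ['X]: summing over the leaf gives ['X] times the
    slice where the leaf is 0. *)
Definition leaf_weight (b : 'I_2) : {poly R} := if b == ord0 then 1 else 'X - 1.

(** This puts the rows [x_0], [x_1], [y_0] at the unit vectors of columns 0,
    1, 2.  The only other nonzero entry of [y] lies in the column of the values
    (1, 1), outside the cubic. *)
Definition inner_weight (u : state5) : {poly R} :=
  ((u (@node 0 isT) == u (@node 1 isT) :> 'I_2) &&
   (u (@node 2 isT) == u mid :> 'I_2))%:R.

(** A curve through the component [q = r = 0], reached at ['X = 0]; only
    the first order along it matters. *)
Definition curve : {mpoly R[#|state5|]} -> {poly R} :=
  mmap polyC (fun k => let u : state5 := enum_val k in
                       leaf_weight (u leaf) * inner_weight u).

HB.instance Definition _ := GRing.RMorphism.on curve.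

Lemma curve_pvar u : curve (pvar R u) = leaf_weight (u leaf) * inner_weight u.
Proof. by rewrite /curve /pvar mmapX mmap1U enum_rankK. Qed.

Lemma inner_weight_upd u b : inner_weight (upd u leaf b) = inner_weight u.
Proof. by rewrite /inner_weight !ffunE. Qed.

Lemma sum_leaf (P : pred state5) (b : 'I_2) :
  (forall u c, P (upd u leaf c) = P u) ->
  \sum_(u | P u && (u leaf == b)) curve (pvar R u) =
  leaf_weight b * \sum_(u | P u && (u leaf == ord0 :> 'I_2)) inner_weight u.
Proof.
move=> Pupd; rewrite mulr_sumr.
rewrite (reindex_onto (fun u => upd u leaf b) (fun u => upd u leaf ord0)) /=.
  apply: eq_big => u; last first.
    by rewrite curve_pvar inner_weight_upd ffunE eqxx.
  rewrite Pupd ffunE eqxx eqxx andbT; congr (_ && _).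
  apply/eqP/eqP => [<-|u0]; first by rewrite ffunE eqxx.
  by apply/ffunP => i; rewrite !ffunE; case: eqP => // ->.
move=> u /andP[_ /eqP ub]; apply/ffunP => i; rewrite !ffunE.
by case: eqP => // ->.
Qed.

Lemma agrees_upd (A : {set 'I_5}) (a : values (binary 5) A) u c :
  leaf \notin A -> agrees (upd u leaf c) a = agrees u a.
Proof.
move=> lA; apply: eq_forallb => -[i iA]; rewrite ffunE /=.
by case: (eqVneq i leaf) => // il; rewrite -il iA in lA.
Qed.

Lemma curve_pmarg_leaf (B C : {set 'I_5}) (a : values (binary 5) [set leaf])
    (b : values (binary 5) B) (c : values (binary 5) C) :
  leaf \notin B -> leaf \notin C ->
  curve (pmarg R a b c) =
  leaf_weight (a (exist _ leaf (set11 leaf))) *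
  \sum_(u | (agrees u b && agrees u c) && (u leaf == ord0 :> 'I_2)) inner_weight u.
Proof.
move=> lB lC; rewrite -sum_leaf => [|u e]; last by rewrite !agrees_upd.
rewrite rmorph_sum; apply: eq_bigl => u; rewrite andbC; congr (_ && _).
apply/forallP/eqP => [/(_ (exist _ leaf (set11 leaf)))/eqP // |ua [i il]].
have ei : i = leaf by apply/set1P.
move: il; rewrite ei => il; rewrite /= ua.
by rewrite (_ : exist _ _ _ = exist _ leaf il) //; apply: val_inj.
Qed.

Lemma curve_pmarg_other (A B C : {set 'I_5}) (a : values (binary 5) A)
    (b : values (binary 5) B) (c : values (binary 5) C) :
  leaf \notin A -> leaf \notin B -> leaf \notin C ->
  'X %| curve (pmarg R a b c).
Proof.
move=> lA lB lC; rewrite rmorph_sum /=.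
rewrite (partition_big (fun u : state5 => u leaf : 'I_2) predT) //= sum_bit.
rewrite !sum_leaf; try by move=> u e; rewrite !agrees_upd.
rewrite -mulrDl (_ : _ + _ = 'X) ?dvdp_mulr //.
by rewrite /leaf_weight /= addrC subrK.
Qed.

(** At the leaf, the image of a marginal factors as (a function of the leaf)
    times (a function of the rest), so that the generators vanish.  Every
    other vertex is an ancestor of the leaf, so that its statement sums over
    the leaf; each marginal is then divisible by ['X]. *)
Lemma curve_local f : J f -> 'X^2 %| curve f.
Proof.
pose K (f : {mpoly R[#|state5|]}) : Prop := 'X^2 %| curve f.
have KI : ideal_closed K.
  split; rewrite /K.
  - by rewrite rmorph0 dvdp0.
  - by move=> g h Kg Kh; rewrite rmorphD dvdp_add.
  - by move=> h g Kg; rewrite rmorphM dvdp_mull.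
apply: (sum_ideal_min KI) => _ g /imsetP[i _ ->].
apply: (gen_ideal_min KI) => {}g [a [a' [b [b' [c ->]]]]].
have lnd : leaf \notin nd funnel i by rewrite !inE connect_leaf !andbF.
have lpa : leaf \notin pa funnel i by rewrite inE.
rewrite /K rmorphB !rmorphM /=.
case: (eqVneq i leaf) => [il|il].
  subst i.
  by rewrite !curve_pmarg_leaf // mulrACA [X in _ - X]mulrACA [X in _ - _ * X]mulrC
             subrr dvdp0.
have li : leaf \notin [set i] by rewrite inE eq_sym.
by rewrite dvdp_sub // expr2 dvdp_mul // curve_pmarg_other.
Qed.

Lemma curve_slice c e i j :
  curve (slice R c e i j) =
  (if e then 'X - 1 else 1) * ((i == (j == 1%N)) && ((j == 2) == c))%:R.
Proof.
have bit_eq a b : (bit a == bit b) = (a == b) by case: a; case: b.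
rewrite /slice curve_pvar /inner_weight !ffunE /= !bit_eq.
by rewrite /leaf_weight; case: e.
Qed.

Lemma curve_cubic : curve (cubic R) = 'X.
Proof.
rewrite /cubic /det3 /slice_sum !(rmorphD, rmorphN, rmorphM) /= !curve_slice /=.
by ring.
Qed.

End DualNumbers.

Theorem proposition9 (R : realType) :
  exists G : rel 'I_5,
    acyclic G /\ ~ is_radical (local_ideal R (binary 5) G).
Proof.
exists funnel; split; first exact: funnel_acyclic.
move=> /(_ (cubic R) 2 isT (cubic_sqr_local R)) /curve_local.
by rewrite curve_cubic -{2}['X]expr1 dvdp_Pexp2l // size_polyX.
Qed.
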